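(* For a typical homogenized spectral pencil $T_\lambda$ of general type the set $\Gamma_2$ is finite. That is, there is a proper real-algebraic subset of the space of coefficients $(a_{i,j})_{0\le j\le i\le k}$ such that $\Gamma_2$ is finite for every pencil of general type whose coefficients lie outside this subset.
   Context: A homogenized spectral pencil is a family $T_\lambda=\sum_{i=0}^k Q_i(z)\lambda^{k-i}\frac{d^i}{dz^i}$, $\lambda\in\mathbb{C}$, where each $Q_i(z)=\sum_{j=0}^i a_{i,j}z^j$ is a complex polynomial of degree at most $i$. Its characteristic equation is $a_{k,k}+a_{k-1,k-1}t+\dots+a_{0,0}t^k=0$. The pencil is of general type if (i) $\deg Q_k=k$ (i.e. $a_{k,k}\neq0$), and (ii) no two roots of the characteristic equation lie on a line through the origin (in particular, $0$ is not a root); it is understood that the characteristic equation has $k$ distinct roots (so $a_{0,0}\ne 0$). Let $\gamma_1,\dots,\gamma_k$ denote the (local) branches of the curve $\sum_{i=0}^kQ_i(z)w^i=0$ over the $z$-plane (away from the zeros of $Q_k$), and let $A_i=\alpha\gamma_i$, where $\alpha$ is a root of the characteristic equation (the conditions below do not depend on the choice of $\alpha$). The set $\Gamma_2\subset\mathbb{C}$ consists of the points $p$ such that either $A_i(p)=A_l(p)$ for some pair of distinct indices $i,l$ (branch points), or the condition $A_i(p)-A_l(p)\in\mathbb{R}\,(A_j(p)-A_l(p))$ holds for at least two distinct triples $\{i,j,l\}$ of pairwise distinct indices in $\{1,\dots,k\}$. (The condition for a triple depends only on the set $\{i,j,l\}$ when the three values are distinct.) The coefficient space is regarded as a real affine space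 via real and imaginary parts of the $a_{i,j}$. *)

(* Defs.v *)
From HB Require Import structures.
From mathcomp Require Import all_boot all_order all_algebra.
From mathcomp Require Import classical_sets cardinality reals complex.
From mathcomp Require Import mpoly.

Set Implicit Arguments.
Unset Strict Implicit.
Unset Printing Implicit Defensive.

Import GRing.Theory Num.Theory.
Local Open Scope ring_scope.
Local Open Scope complex_scope.
Local Open Scope classical_set_scope.

(* The pencil T_lambda = sum_(i <= k) Q_i(z) lambda^(k-i) (d/dz)^i is
   represented by its coefficients a i j (0 <= j <= i <= k), where
   Q_i = sum_(j <= i) a i j z^j. *)
Definition pencil (R : realType) (k : nat) : Type :=
  forall i : 'I_k.+1, 'I_i.+1 -> R[i].

Section Pencil.
Variables (R : realType) (k : nat).
Implicit Types (a : pencil R k) (A : 'I_k -> R[i]).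

Definition Qpoly a (i : 'I_k.+1) : {poly R[i]} :=
  \sum_(j < i.+1) a i j *: 'X^j.

Definition charpoly a : {poly R[i]} :=
  \sum_(i < k.+1) a i ord_max *: 'X^(k - i).

Definition same_line_through_origin (x y : R[i]) : Prop :=
  exists2 u : R[i], u != 0 &
    exists r s : R, x = r%:C * u /\ y = s%:C * u.

Definition general_type a : Prop :=
  [/\ size (Qpoly a ord_max) = k.+1,
      exists t : seq R[i], [/\ uniq t, size t = k & all (root (charpoly a)) t]
    & forall x y : R[i], root (charpoly a) x -> root (charpoly a) y ->
        x != y -> ~ same_line_through_origin x y].

(* The equation sum_i Q_i(z) w^i = 0 at z = p, as a polynomial in w. *)
Definition fiber_poly a (p : R[i]) : {poly R[i]} :=
  \sum_(i < k.+1) (Qpoly a i).[p] *: 'X^i.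

(* The values at p of the local branches gamma_1, ..., gamma_k, in some order:
   the roots w of the fiber over p, listed with multiplicity. *)
Definition branch_values a (p : R[i]) (gamma : 'I_k -> R[i]) : Prop :=
  fiber_poly a p = (Qpoly a ord_max).[p] *: \prod_(i < k) ('X - (gamma i)%:P).

(* Triples are unordered; when the three values of A are distinct the condition
   does not depend on the enumeration of the triple. *)
Definition collinear_triple A (T : {set 'I_k}) : Prop :=
  exists i j l : 'I_k,
    [/\ [&& i != j, j != l & i != l], T = [set i; j; l]%SET
      & exists r : R, A i - A l = r%:C * (A j - A l)].

(* Zeros of Q_k are excluded: some branch is infinite there. *)
Definition Gamma2 a (alpha : R[i]) : set R[i] :=
  [set p | (Qpoly a ord_max).[p] != 0 /\
     exists2 gamma : 'I_k -> R[i], branch_values a p gamma &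
       let A i := alpha * gamma i in
       (exists i l : 'I_k, i != l /\ A i = A l) \/
       (exists T1 T2 : {set 'I_k},
          [/\ T1 != T2, collinear_triple A T1 & collinear_triple A T2])].

(* One real coordinate for the real part (false) and one for the imaginary
   part (true) of each coefficient a i j. *)
Definition real_index : finType :=
  ({i : 'I_k.+1 & 'I_i.+1} * bool)%type.

Definition real_coord a (x : 'I_#|real_index|) : R :=
  let: (existT i j, b) := enum_val x in
  if b then complex.Im (a i j) else complex.Re (a i j).

Definition real_algebraic (Z : set (pencil R k)) : Prop :=
  exists S : seq ({mpoly R[#|real_index|]}),
    Z = [set a | forall f, f \in S -> f.@[real_coord a] = 0].

End Pencil.

(* Main.v *)
Require Import Defs.
From mathcomp Require Import all_boot all_order all_algebra.
From mathcomp Require Import boolp classical_sets cardinality reals complex.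
From mathcomp Require Import mpoly.
From mathcomp Require Import zify ring.

(** The proof is a dimension count.  Let N be the number of complex
    coefficients of a pencil, so that the coefficient space has real dimension
    2N.  If the branch values at p are collinear for two distinct triples, or
    if two of them coincide, then the values gamma_1, ..., gamma_k satisfy two
    independent real conditions, and so are described by 2k - 2 real
    parameters, polynomially.  Two more real parameters give p itself.
    Once p and gamma are known, the identity

      sum_i Q_i(p) w^i = Q_k(p) prod_l (w - gamma_l)

    determines the k constant terms a_(i,0), i < k, polynomially from the
    remaining N - k coefficients.  Hence all pairs (pencil, bad point) of a
    given combinatorial type lie in the image of a polynomial map defined on a
    real space of dimension 2(N - k) + (2k - 2) + 2 = 2N.

    The 2N real coordinates of the pencil and the real part of p are therefore
    2N + 1 polynomials in 2N variables, and they are algebraically dependent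
    ([algebraic_dependence]).  The relation, read as a polynomial in the last
    quantity, has for its leading coefficient a nonzero polynomial f in the
    coefficients of the pencil; when f does not vanish, Re p is a root of a
    nonzero polynomial depending on the pencil alone, so it takes finitely many values
    ([generic_fiber_finite]).  The same holds for Im p.  The exceptional set is
    the zero set of the product of these f over all the parts and all the
    combinatorial types.

    Since the parameter space has the dimension of the coefficient space, it is
    identified with the latter: the entries c_(i,0), i < k, of an arbitrary
    pencil c are reused as the parameters for p and gamma
    ([pencil_through], [refill]).  Generality of type gives
    a_(k,k) <> 0, hence alpha <> 0, so that coincidences and collinearities of
    the A_i are those of the gamma_i ([Gamma2_sub]). *)

Set Implicit Arguments.
Unset Strict Implicit.
Unset Printing Implicit Defensive.

Import GRing.Theory Num.Theory.

Local Open Scope ring_scope.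
Local Open Scope complex_scope.
Local Open Scope classical_set_scope.

(** * Algebraic dependence of n + 1 polynomials in n variables *)

Lemma linear_dependence (K : fieldType) (I J : finType) (w : I -> J -> K) :
  (#|J| < #|I|)%N ->
  exists2 c : I -> K, exists i, c i != 0
    & forall j, \sum_i c i * w i j = 0.
Proof.
move=> ltJI.
pose A := \matrix_(i < #|I|, j < #|J|) w (enum_val i) (enum_val j).
have kerA : kermx A != 0.
  by rewrite -mxrank_eq0 mxrank_ker subn_eq0 -ltnNge (leq_ltn_trans (rank_leq_col A)).
pose u := nz_row (kermx A).
have uA : u *m A = 0 by apply/sub_kermxP/nz_row_sub.
exists (fun i => u 0 (enum_rank i)).
  have : u != 0 by rewrite nz_row_eq0.
  case/rV0Pn=> i ui; exists (enum_val i).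
  by rewrite enum_valK.
move=> j; move/rowP/(_ (enum_rank j)): uA; rewrite !mxE; apply: etrans.
rewrite [RHS](reindex _ (onW_bij _ (enum_rank_bij I))) /=.
by apply: eq_bigr => i _; rewrite mxE !enum_rankK.
Qed.

Lemma msizeM_leS (K : fieldType) n (p q : {mpoly K[n]}) a b :
  (msize p <= a.+1 -> msize q <= b.+1 -> msize (p * q) <= (a + b).+1)%N.
Proof.
have [->|nz_p] := eqVneq p 0; first by rewrite mul0r msize0.
have [->|nz_q] := eqVneq q 0; first by rewrite mulr0 msize0.
move=> sp sq; rewrite msizeM // -ltnS prednK ?addn_gt0 ?lt0n ?msize_poly_eq0 ?nz_p //.
by rewrite -addSn -addnS leq_add.
Qed.

(** The relation between the n components of t and the extra polynomial g is
    sought among the polynomials of degree < M in each of the n + 1 unknowns, a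
    space of dimension M ^ (n + 1).  Substituting t and g multiplies degrees by
    at most a constant c independent of M, hence maps this space into one of
    dimension at most (c M) ^ n, which is smaller as soon as M > c ^ n.  The
    unknown that stands for g is the variable of the outer polynomial ring. *)
Lemma algebraic_dependence (K : fieldType) n
    (t : n.-tuple {mpoly K[n]}) (g : {mpoly K[n]}) :
  exists2 F : {poly {mpoly K[n]}}, F != 0
    & (map_poly (comp_mpoly t) F).[g] = 0.
Proof.
pose d := maxn (msize g) (\max_(i < n) msize (tnth t i)).
pose c := (1 + n.+1 * d)%N.
pose M := (c ^ n).+1.
pose D := (c * M)%N.
pose I : finType := ({ffun 'I_n -> 'I_M} * 'I_M)%type.
pose J : finType := {ffun 'I_n -> 'I_D}.
have ltJI : (#|J| < #|I|)%N.
  rewrite card_prod !card_ffun !card_ord /D expnMn mulnC ltn_pmul2l //.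
  by rewrite expn_gt0.
pose mon (e : {ffun 'I_n -> 'I_M}) : 'X_{1..n} := [multinom (e i : nat) | i < n].
pose img (i : I) := ('X_[mon i.1] \mPo t) * g ^+ i.2.
have size_exp (p : {mpoly K[n]}) (j : 'I_M) :
    (msize p <= d -> msize (p ^+ j) <= (M * d).+1)%N.
  move=> sp; apply: (@leq_trans (j * d).+1); last first.
    by rewrite ltnS leq_mul2r (ltnW (ltn_ord j)) orbT.
  elim: (j : nat) => [|i IHi]; first by rewrite expr0 msize1.
  by rewrite exprS mulSn msizeM_leS // (leq_trans sp).
have size_img i : (msize (img i) <= D)%N.
  have D_ge : (((\sum_(l < n) M * d) + M * d).+1 <= D)%N.
    by rewrite sum_nat_const card_ord /D /c; lia.
  apply: leq_trans D_ge; apply: msizeM_leS; last first.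
    by apply: size_exp; rewrite leq_maxl.
  rewrite comp_mpolyX.
  elim/big_ind2: _ => [|p a q e|l _]; first by rewrite msize1.
    exact: msizeM_leS.
  rewrite mnmE; apply: size_exp; rewrite leq_max; apply/orP; right.
  exact: (leq_bigmax l).
(* w lists the coefficients of the images of the monomials; those at
   exponents outside J vanish because of size_img. *)
pose w i (j : J) := (img i)@_[multinom (j l : nat) | l < n].
have [b [[e0 j0] nz_b] b_img] := linear_dependence w ltJI.
pose F : {poly {mpoly K[n]}} :=
  \sum_i (b i *: 'X_[mon i.1]) *: 'X^(i.2).
exists F.
  apply: contraNneq nz_b => F0.
  move/(congr1 (fun G : {poly {mpoly K[n]}} => (G`_j0)@_(mon e0))): F0.
  rewrite coef0 mcoeff0 coef_sum raddf_sum (bigD1 (e0, j0)) //= big1 => [|[e j] ne].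
    by rewrite addr0 coefZ coefXn eqxx mulr1 mcoeffZ mcoeffX eqxx mulr1 => ->.
  rewrite coefZ coefXn /=; case: eqVneq => [/val_inj eqj|_]; last by rewrite mulr0 mcoeff0.
  rewrite mulr1 mcoeffZ mcoeffX; case: eqVneq => [eqe|_]; last by rewrite mulr0.
  case/eqP: ne; congr (_, _) => //; apply/ffunP=> l; apply: val_inj.
  by move/mnmP/(_ l): eqe; rewrite !mnmE.
have -> : (map_poly (comp_mpoly t) F).[g] = \sum_i b i *: img i.
  rewrite raddf_sum /= horner_sum; apply: eq_bigr => i _.
  rewrite map_polyZ /= map_polyXn hornerZ hornerXn.
  by rewrite comp_mpolyZ -scalerAl.
apply/mpolyP=> m; rewrite mcoeff0 raddf_sum /=.
case: (boolP [forall l, m l < D]%N) => [/forallP ltm|].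
  rewrite -[RHS](b_img [ffun l => Ordinal (ltm l)]); apply: eq_bigr => i _.
  rewrite mcoeffZ /w; congr (_ * mcoeff _ _); apply/mnmP=> l.
  by rewrite mnmE ffunE.
case/forallPn=> l; rewrite -leqNgt => leDm; apply: big1 => i _.
rewrite mcoeffZ memN_msupp_eq0 ?mulr0 // msize_mdeg_ge //.
rewrite (leq_trans (size_img i)) // (leq_trans leDm) // mdegE.
by rewrite (bigD1 l) //= leq_addr.
Qed.

(** * Zeros of polynomials and generic finiteness of fibers *)

Lemma exists_nonroot (K : numFieldType) (q : {poly K}) :
  q != 0 -> exists x, q.[x] != 0.
Proof.
move=> nz_q; pose rs := [seq i%:R : K | i <- iota 0 (size q)].
have /allPn[x _ qx] : ~~ all (root q) rs.
  apply/negP=> rs_roots; suff: (size rs < size q)%N by rewrite size_map size_iota ltnn.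
  apply: max_poly_roots rs_roots _ => //.
  by rewrite map_inj_uniq ?iota_uniq // => i j /eqP; rewrite eqr_nat => /eqP.
by exists x.
Qed.

Lemma finite_roots (K : idomainType) (q : {poly K}) :
  q != 0 -> finite_set [set x | root q x].
Proof.
move=> nz_q; apply: contrapT => /(infinite_set_fset (size q))[B B_roots].
apply/negP; rewrite -ltnNge; apply: max_poly_roots (finmap.fset_uniq B) => //.
by apply/allP=> x /B_roots.
Qed.

Lemma meval_muni (K : comNzRingType) n (f : {mpoly K[n.+1]}) (v : 'I_n.+1 -> K) :
  f.@[v] = (map_poly (meval (v \o widen_ord (leqnSn n))) (muni f)).[v ord_max].
Proof.
rewrite mevalE muniE raddf_sum horner_sum; apply: eq_bigr => m _ /=.
rewrite map_polyZ map_polyXn hornerZ hornerXn /= mevalZ mevalX big_ord_recr /= mulrA.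
by congr (_ * _ * _); apply: eq_bigr => i _; rewrite mnmE.
Qed.

Lemma muni_eq0 (K : nzRingType) n (f : {mpoly K[n.+1]}) : (muni f == 0) = (f == 0).
Proof.
apply/eqP/eqP=> [f0|->]; last exact: muni0.
apply/mpolyP=> m; rewrite mcoeff0.
pose m' := [multinom m (widen_ord (leqnSn n) i) | i < n].
move/(congr1 (fun G : {poly {mpoly K[n]}} => (G`_(m ord_max))@_m')): f0.
rewrite coef0 mcoeff0 muniE coef_sum raddf_sum /=.
have [m_f|m_nf _] := boolP (m \in msupp f); last exact: memN_msupp_eq0.
rewrite (bigD1_seq m) //= big1 => [|e ne_em].
  by rewrite addr0 coefZ coefXn eqxx mulr1 mcoeffZ mcoeffX eqxx mulr1.
rewrite coefZ coefXn; case: eqVneq => [eq_max|_]; last by rewrite mulr0 mcoeff0.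
rewrite mulr1 mcoeffZ mcoeffX; case: eqVneq => [eq_w|_]; last by rewrite mulr0.
case/eqP: ne_em; apply/mnmP=> i.
have [[j ->]|->] : (exists j, i = widen_ord (leqnSn n) j) \/ i = ord_max.
- have [lt_in|ge_in] := ltnP i n; first by left; exists (Ordinal lt_in); apply: val_inj.
  by right; apply: val_inj; apply/eqP; rewrite eqn_leq ge_in -ltnS ltn_ord.
- by move/mnmP/(_ j): eq_w; rewrite !mnmE.
by [].
Qed.

(** The last variable is split off: the leading coefficient of f with respect
    to it is nonzero at some point v of the remaining variables by induction,
    and the univariate polynomial obtained by specializing at v has a
    nonroot. *)
Lemma exists_nonzero (K : numFieldType) n (f : {mpoly K[n]}) :
  f != 0 -> exists v, f.@[v] != 0.
Proof.
elim: n f => [|n IHn] f nz_f.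
  exists (fun=> 0); apply: contraNneq nz_f => f0; apply/eqP/mpolyP=> m.
  move: f0; rewrite mevalE mcoeff0 => f0.
  have [m_f|] := boolP (m \in msupp f); last exact: memN_msupp_eq0.
  move: f0; rewrite (bigD1_seq m) //= big_ord0 mulr1 big1 ?addr0 // => e.
  by case/eqP; apply/mnmP; case.
have [v nz_v] : exists v, (lead_coef (muni f)).@[v] != 0.
  by apply: IHn; rewrite lead_coef_eq0 muni_eq0.
have /exists_nonroot[x nz_x] : map_poly (meval v) (muni f) != 0.
  apply: contraNneq nz_v => /(congr1 (fun G : {poly K} => G`_(size (muni f)).-1)).
  by rewrite coef_map coef0 => ->.
exists (fun i => if unlift ord_max i is Some j then v j else x).
rewrite meval_muni unlift_none.
congr (_ != 0): nz_x; congr (horner _ _).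
apply: eq_map_poly => p; apply: meval_eq => i /=.
have -> : widen_ord (leqnSn n) i = lift ord_max i.
  by apply: val_inj; rewrite /= /bump leqNgt ltn_ord.
by rewrite liftK.
Qed.

(** Generically a polynomial map t between spaces of the same dimension has
    finite fibers as seen by any polynomial function g.  The relation F between
    t and g, specialized at a point x, annihilates the values of g over x, and
    this specialization is a nonzero polynomial where the leading coefficient
    of F does not vanish. *)
Lemma generic_fiber_finite (K : numFieldType) n
    (t : n.-tuple {mpoly K[n]}) (g : {mpoly K[n]}) :
  exists2 f : {mpoly K[n]}, f != 0
    & forall x : 'I_n -> K, f.@[x] != 0 ->
        finite_set [set g.@[v] | v in [set v | forall i, (tnth t i).@[v] = x i]].
Proof.
have [F nz_F F_tg] := algebraic_dependence t g.
exists (lead_coef F) => [|x nz_x]; first by rewrite lead_coef_eq0.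
have nz_Fx : map_poly (meval x) F != 0.
  apply: contraNneq nz_x => /(congr1 (fun G : {poly K} => G`_(size F).-1)).
  by rewrite coef_map coef0 => ->.
apply: sub_finite_set (finite_roots nz_Fx) => _ [v /= tv <-].
move/(congr1 (meval v)): F_tg; rewrite meval0 -horner_map -map_poly_comp.
rewrite rootE => /eqP; congr (horner _ _ == 0); apply: eq_map_poly => p /=.
by rewrite comp_mpoly_meval; apply: meval_eq.
Qed.

(** * Polynomial functions of the coefficients of a pencil *)

Section PencilPolynomials.
Variables (R : realType) (k : nat).
Implicit Types (a c : pencil R k) (P : pencil R k -> R[i]).

Lemma real_coord_surj (x : 'I_#|real_index k| -> R) :
  exists a, real_coord a = x.
Proof.
pose xi i j b := x (enum_rank ((existT _ i j, b) : real_index k)).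
exists (fun i j => xi i j false +i* xi i j true).
apply: funext => l; rewrite /real_coord /xi.
by case def_l: (enum_val l) => [[i j] []] /=; rewrite -def_l enum_valK.
Qed.

(** Polynomials in the real and imaginary parts, not only in the complex
    coefficients: this makes the real and imaginary parts of such a function
    polynomial again. *)
Definition polynomial_in_coefs P :=
  exists q r : {mpoly R[#|real_index k|]},
    forall c, P c = q.@[real_coord c] +i* r.@[real_coord c].

Lemma polynomial_cst (z : R[i]) : polynomial_in_coefs (fun=> z).
Proof.
by exists (complex.Re z)%:MP, (complex.Im z)%:MP => c; rewrite !mevalC; case: z.
Qed.

Lemma polynomial_coef i j : polynomial_in_coefs (fun c => c i j).
Proof.
pose x b := enum_rank ((existT _ i j, b) : real_index k).
exists 'X_(x false), 'X_(x true) => c.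
by rewrite !mevalXU /real_coord !enum_rankK; case: (c i j).
Qed.

Lemma polynomialD P1 P2 :
  polynomial_in_coefs P1 -> polynomial_in_coefs P2 ->
  polynomial_in_coefs (fun c => P1 c + P2 c).
Proof.
move=> [q1 [r1 P1E]] [q2 [r2 P2E]]; exists (q1 + q2), (r1 + r2) => c.
by rewrite P1E P2E !mevalD.
Qed.

Lemma polynomialN P :
  polynomial_in_coefs P -> polynomial_in_coefs (fun c => - P c).
Proof. by move=> [q [r PE]]; exists (- q), (- r) => c; rewrite PE !mevalN. Qed.

Lemma polynomialM P1 P2 :
  polynomial_in_coefs P1 -> polynomial_in_coefs P2 ->
  polynomial_in_coefs (fun c => P1 c * P2 c).
Proof.
move=> [q1 [r1 P1E]] [q2 [r2 P2E]].
exists (q1 * q2 - r1 * r2), (q1 * r2 + r1 * q2) => c.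
by rewrite P1E P2E mevalB mevalD !mevalM.
Qed.

Lemma polynomial_sum (I : Type) (s : seq I) (F : I -> pencil R k -> R[i]) :
  (forall x, polynomial_in_coefs (F x)) ->
  polynomial_in_coefs (fun c => \sum_(x <- s) F x c).
Proof.
move=> polyF; elim: s => [|x s IHs].
  by under eq_fun do rewrite big_nil; apply: polynomial_cst.
by under eq_fun do rewrite big_cons; apply: polynomialD.
Qed.

Lemma polynomialX P n :
  polynomial_in_coefs P -> polynomial_in_coefs (fun c => P c ^+ n).
Proof.
move=> polyP; elim: n => [|n IHn]; first exact: polynomial_cst.
by under eq_fun do rewrite exprS; apply: polynomialM.
Qed.

Lemma polynomial_Re P :
  polynomial_in_coefs P -> polynomial_in_coefs (fun c => (complex.Re (P c))%:C).
Proof. by move=> [q [r PE]]; exists q, 0 => c; rewrite PE meval0. Qed.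

Lemma polynomial_Im P :
  polynomial_in_coefs P -> polynomial_in_coefs (fun c => (complex.Im (P c))%:C).
Proof. by move=> [q [r PE]]; exists r, 0 => c; rewrite PE meval0. Qed.

Lemma polynomial_coef_prod_XsubC (I : Type) (s : seq I)
    (G : pencil R k -> I -> R[i]) (n : nat) :
  (forall l, polynomial_in_coefs (G^~ l)) ->
  polynomial_in_coefs (fun c => (\prod_(l <- s) ('X - (G c l)%:P))`_n).
Proof.
move=> polyG; elim: s n => [|l s IHs] n.
  by under eq_fun do rewrite big_nil; apply: polynomial_cst.
under eq_fun do rewrite big_cons coefM.
apply: polynomial_sum => m; apply: polynomialM => //.
under eq_fun do rewrite coefB coefC.
apply: polynomialD; first exact: polynomial_cst.
apply: polynomialN; case: (m == 0%N :> nat) => //.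
exact: polynomial_cst.
Qed.

Lemma polynomial_horner_Qpoly P i :
  polynomial_in_coefs P ->
  polynomial_in_coefs (fun c => (Qpoly c i).[P c]).
Proof.
move=> polyP; under eq_fun do rewrite horner_sum.
apply: polynomial_sum => j; under eq_fun do rewrite hornerZ hornerXn.
by apply: polynomialM; [apply: polynomial_coef | apply: polynomialX].
Qed.

(** * Generically finite families of sets *)

Definition generically_finite (B : pencil R k -> set R[i]) :=
  exists2 f : {mpoly R[#|real_index k|]}, f != 0
    & forall a, f.@[real_coord a] != 0 -> finite_set (B a).

Lemma sub_generically_finite (A B : pencil R k -> set R[i]) :
  (forall a, A a `<=` B a) -> generically_finite B -> generically_finite A.
Proof.
move=> sAB [f nz_f fin_B]; exists f => // a /fin_B; exact: sub_finite_set.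
Qed.

Lemma generically_finite_setU (A B : pencil R k -> set R[i]) :
  generically_finite A -> generically_finite B ->
  generically_finite (fun a => A a `|` B a).
Proof.
move=> [f nz_f fin_A] [g nz_g fin_B]; exists (f * g); first by rewrite mulf_neq0.
move=> a; rewrite mevalM mulf_eq0 negb_or finite_setU => /andP[fa ga].
by split; [apply: fin_A | apply: fin_B].
Qed.

Lemma generically_finite_bigcup (I : finType) (B : I -> pencil R k -> set R[i]) :
  (forall x, generically_finite (B x)) ->
  generically_finite (fun a => \bigcup_x B x a).
Proof.
move=> /(_ _)/cid2-/all_sig2[f nz_f fin_B]; exists (\prod_x f x).
  by apply/prodf_neq0 => x _; apply: nz_f.
move=> a; rewrite rmorph_prod /= => /prodf_neq0 nz_fa.
by apply: bigcup_finite => // x _; apply: fin_B; apply: nz_fa.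
Qed.

(** The form in which the dimension count is used: Phi goes from the coefficient
    space to itself, so that the real and imaginary parts of P over a generic
    fiber each take finitely many values. *)
Lemma polynomial_map_generically_finite
    P (Phi : pencil R k -> pencil R k) :
  polynomial_in_coefs P ->
  (forall i j, polynomial_in_coefs (fun c => Phi c i j)) ->
  generically_finite (fun a => [set P c | c in [set c | Phi c = a]]).
Proof.
move=> [q [r PE]] polyPhi.
have [t Phi_t] : exists t : #|real_index k|.-tuple {mpoly R[#|real_index k|]},
    forall c x, real_coord (Phi c) x = (tnth t x).@[real_coord c].
  have /fin_all_exists[h Phi_h] : forall x, exists h : {mpoly R[#|real_index k|]},
      forall c, real_coord (Phi c) x = h.@[real_coord c].
    move=> x; rewrite /real_coord; case: (enum_val x) => -[i j] b.
    have [q' [r' PhiE]] := polyPhi i j.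
    by exists (if b then r' else q') => c; rewrite PhiE; case: b.
  by exists [tuple h x | x < _] => c x; rewrite tnth_mktuple.
have [f nz_f fin_q] := generic_fiber_finite t q.
have [g nz_g fin_r] := generic_fiber_finite t r.
exists (f * g); first by rewrite mulf_neq0.
move=> a; rewrite mevalM mulf_eq0 negb_or => /andP[/fin_q fin_qa /fin_r fin_ra].
pose toC (z : R * R) := z.1 +i* z.2.
apply: sub_finite_set (finite_image toC (finite_setX fin_qa fin_ra)).
move=> _ [c /= Phic <-]; exists (q.@[real_coord c], r.@[real_coord c]) => //=.
by split; exists (real_coord c) => //= x; rewrite -Phi_t Phic.
Qed.

(** * Pencils with prescribed branch values at a point *)

(** The constant terms c_(l,0), l < k, are the entries of a pencil that are
    recomputed from the branch values; their places hold free parameters. *)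
Definition slot c (l : 'I_k) : R[i] := c (widen_ord (leqnSn k) l) ord0.

Definition refill a (u : 'I_k -> R[i]) : pencil R k := fun i j =>
  oapp u (a i j) (if j == ord0 then insub (i : nat) else None).

(** The pencil whose fiber polynomial at [P c] is
    Q_k(P c) prod_l (w - G c l): comparing coefficients of w^i gives the value
    of Q_i at [P c], from which the constant term of Q_i follows by subtracting
    the other terms, taken from c. *)
Definition pencil_through P (G : pencil R k -> 'I_k -> R[i]) c : pencil R k :=
  fun i j =>
    if (j == ord0) && (i < k)%N then
      (Qpoly c ord_max).[P c] * (\prod_l ('X - (G c l)%:P))`_i
        - ((Qpoly c i).[P c] - c i ord0)
    else c i j.

Arguments refill a u i j : clear implicits.
Arguments pencil_through P G c i j : clear implicits.

Lemma slot_refill a u l : slot (refill a u) l = u l.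
Proof. by rewrite /slot /refill eqxx /= valK. Qed.

Lemma refill_id a u (i : 'I_k.+1) (j : 'I_i.+1) :
  ~~ ((j == ord0) && (i < k)%N) -> refill a u i j = a i j.
Proof. by rewrite /refill; case: (j == ord0) => //= lt_ik; rewrite insubN. Qed.

Lemma Qpoly_refill a u p (i : 'I_k.+1) :
  (Qpoly (refill a u) i).[p] - refill a u i ord0 = (Qpoly a i).[p] - a i ord0.
Proof.
rewrite /Qpoly !horner_sum !big_ord_recl /= !hornerZ !hornerXn !expr0 !mulr1.
rewrite !(addrAC _ _ (- _)) !subrr !add0r; apply: eq_bigr => j _.
by rewrite !hornerZ refill_id.
Qed.

Lemma Qpoly_max_refill a u : Qpoly (refill a u) ord_max = Qpoly a ord_max.
Proof.
by apply: eq_bigr => j _; rewrite refill_id //= ltnn andbF.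
Qed.

Lemma coef_fiber_poly a p (i : 'I_k.+1) : (fiber_poly a p)`_i = (Qpoly a i).[p].
Proof.
rewrite coef_sum (bigD1 i) //= coefZ coefXn eqxx mulr1 big1 ?addr0 // => j ne_ji.
by rewrite coefZ coefXn eq_sym (inj_eq val_inj) (negbTE ne_ji) mulr0.
Qed.

Lemma polynomial_pencil_through P (G : pencil R k -> 'I_k -> R[i]) :
  polynomial_in_coefs P -> (forall l, polynomial_in_coefs (G^~ l)) ->
  forall i j, polynomial_in_coefs (fun c => pencil_through P G c i j).
Proof.
move=> polyP polyG i j; rewrite /pencil_through.
case: (_ && _); last exact: polynomial_coef.
apply: polynomialD.
  apply: polynomialM; first exact: polynomial_horner_Qpoly.
  exact: polynomial_coef_prod_XsubC.
apply: polynomialN; apply: polynomialD; first exact: polynomial_horner_Qpoly.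
by apply: polynomialN; apply: polynomial_coef.
Qed.

(** Every pencil arises from the construction, whatever its branch values gamma
    at p, once the free slots are filled so as to produce p and gamma. *)
Lemma pencil_through_refill P (G : pencil R k -> 'I_k -> R[i]) a p gamma u :
  branch_values a p gamma -> P (refill a u) = p -> G (refill a u) =1 gamma ->
  pencil_through P G (refill a u) = a.
Proof.
move=> branch Pu Gu; apply: functional_extensionality_dep => i; apply: funext => j.
rewrite /pencil_through; case: ifP => [/andP[/eqP-> lt_ik]|/negbT]; last exact: refill_id.
rewrite Pu Qpoly_refill Qpoly_max_refill.
under eq_bigr do rewrite Gu.
by rewrite -coefZ -branch coef_fiber_poly opprB addrC subrK.
Qed.

(** A condition C on the branch values costs one complex dimension if the k slots
    suffice to parametrize at once p and the gamma satisfying C. *)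
Lemma parametrized_generically_finite P (G : pencil R k -> 'I_k -> R[i])
    (C : ('I_k -> R[i]) -> Prop) :
  polynomial_in_coefs P -> (forall l, polynomial_in_coefs (G^~ l)) ->
  (forall a p gamma, C gamma ->
     exists u, P (refill a u) = p /\ G (refill a u) =1 gamma) ->
  generically_finite
    (fun a => [set p | exists2 gamma, branch_values a p gamma & C gamma]).
Proof.
move=> polyP polyG cover.
have := polynomial_map_generically_finite polyP (polynomial_pencil_through polyP polyG).
apply: sub_generically_finite => a p [gamma branch /(cover a p)[u [Pu Gu]]].
by exists (refill a u) => //=; apply: pencil_through_refill branch Pu Gu.
Qed.

(** * The two kinds of exceptional branch values *)

Definition branch_coincidence (s : 'I_k * 'I_k) (gamma : 'I_k -> R[i]) :=
  s.1 != s.2 /\ gamma s.1 = gamma s.2.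

Lemma branch_coincidence_generically_finite s :
  generically_finite
    (fun a => [set p | exists2 gamma, branch_values a p gamma
                                    & branch_coincidence s gamma]).
Proof.
case: s => i l.
(* Since gamma i = gamma l, slot i is free to hold p. *)
pose G c m := slot c (if m == i then l else m).
apply: (@parametrized_generically_finite (slot^~ i) G).
- exact: polynomial_coef.
- by move=> m; apply: polynomial_coef.
move=> a p gamma [/= ne_il eq_il].
exists (fun m => if m == i then p else gamma m); rewrite /G !slot_refill eqxx.
split=> // m; rewrite slot_refill; have [->|/negbTE->] // := eqVneq m i.
by rewrite eq_sym (negbTE ne_il).
Qed.

Definition collinear_at (s : 'I_k * 'I_k * 'I_k) (gamma : 'I_k -> R[i]) :=
  exists r : R, gamma s.1.1 - gamma s.2 = r%:C * (gamma s.1.2 - gamma s.2).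

(** Each of the two triples has a vertex that is in neither the rest of its own
    triple nor the other triple, so that it can be solved for independently. *)
Definition two_collinearities
    (s1 s2 : 'I_k * 'I_k * 'I_k) (gamma : 'I_k -> R[i]) :=
  [/\ s1.1.1 \notin [:: s1.1.2; s1.2; s2.1.1; s2.1.2; s2.2],
      s2.1.1 \notin [:: s2.1.2; s2.2; s1.1.1; s1.1.2; s1.2],
      collinear_at s1 gamma & collinear_at s2 gamma].

Lemma two_collinearities_generically_finite s1 s2 :
  generically_finite
    (fun a => [set p | exists2 gamma, branch_values a p gamma
                                    & two_collinearities s1 s2 gamma]).
Proof.
case: s1 s2 => [[i1 j1] l1] [[i2 j2] l2].
(* The points gamma i1 and gamma i2 are each given by one real parameter on a
   line through two others.  Slot i1 holds p, and slot i2 holds both real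
   parameters as its real and imaginary parts. *)
pose on_line (t z w : R[i]) := w + t * (z - w).
pose G c m :=
  if m == i1 then
    on_line (complex.Re (slot c i2))%:C (slot c j1) (slot c l1)
  else if m == i2 then
    on_line (complex.Im (slot c i2))%:C (slot c j2) (slot c l2)
  else slot c m.
have poly_slot l : polynomial_in_coefs (slot^~ l) by apply: polynomial_coef.
have poly_line (t : pencil R k -> R[i]) j l : polynomial_in_coefs t ->
    polynomial_in_coefs (fun c => on_line (t c) (slot c j) (slot c l)).
  move=> polyt; apply: polynomialD => //; apply: polynomialM => //.
  by apply: polynomialD => //; apply: polynomialN.
apply: (@parametrized_generically_finite (slot^~ i1) G).
- exact: poly_slot.
- move=> m; rewrite /G; case: (m == i1).
    by apply: poly_line; apply: polynomial_Re.
  by case: (m == i2) => //; apply: poly_line; apply: polynomial_Im.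
move=> a p gamma [/=]; rewrite !inE !negb_or.
move=> /and5P[i1j1 i1l1 i1i2 i1j2 i1l2] /and5P[i2j2 i2l2 _ i2j1 i2l1].
move=> [r1 /= line1] [r2 /= line2].
pose u m := if m == i1 then p else if m == i2 then r1 +i* r2 else gamma m.
have u_gamma m : i1 != m -> i2 != m -> u m = gamma m.
  by rewrite /u !(eq_sym m) => /negbTE-> /negbTE->.
exists u; split=> [|m]; first by rewrite slot_refill /u eqxx.
rewrite /G !slot_refill !(u_gamma j1, u_gamma l1, u_gamma j2, u_gamma l2) //.
have -> : u i2 = r1 +i* r2 by rewrite /u eq_sym (negbTE i1i2) eqxx.
rewrite /on_line /= -line1 -line2 ![_ + (_ - _)]addrC !subrK.
have [->|ne_mi1] := eqVneq m i1; first by [].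
have [->|ne_mi2] := eqVneq m i2; first by [].
by rewrite u_gamma // eq_sym.
Qed.

(** Collinearity can be solved for any vertex of the triple, because the ratio r
    of distinct points is neither 0 nor 1; the new ratios are 1 / r and
    1 / (1 - r). *)
Lemma collinear_triple_vertex (gamma : 'I_k -> R[i]) (T : {set 'I_k}) i :
  injective gamma -> collinear_triple gamma T -> i \in T ->
  exists j l, [/\ i != j, i != l, T = [set i; j; l]%SET
                & collinear_at (i, j, l) gamma].
Proof.
move=> inj_gamma [x [y [z [/and3P[ne_xy ne_yz ne_xz] -> [r line]]]]].
have nz_sub j l : j != l -> gamma j - gamma l != 0.
  by rewrite subr_eq0 (inj_eq inj_gamma).
have nz_r : r != 0.
  by apply: contraTneq (nz_sub _ _ ne_xz) => r0; rewrite line r0 mul0r eqxx.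
have nz_r1 : 1 - r != 0.
  rewrite subr_eq0 eq_sym; apply: contraTneq (nz_sub _ _ ne_xy) => r1.
  move: line; rewrite r1 mul1r => /addIr->.
  by rewrite subrr eqxx.
have unit_r : r%:C != 0 by rewrite (fmorph_eq0 (real_complex R)).
have unit_r1 : 1 - r%:C != 0.
  by rewrite -(rmorph1 (real_complex R)) -rmorphB (fmorph_eq0 (real_complex R)).
rewrite !inE -orbA => /or3P[] /eqP->.
- by exists y, z; split=> //; exists r.
- exists x, z; split=> //; first by rewrite eq_sym.
    by apply/setP=> m; rewrite !inE [(m == x) || _]orbC.
  exists r^-1 => /=; rewrite line fmorphV mulrA mulVf ?mul1r //.
exists x, y; split; rewrite 1?eq_sym //.
  by apply/setP=> m; rewrite !inE orbC orbA.
exists (1 - r)^-1 => /=.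
rewrite fmorphV rmorphB rmorph1 /=.
have -> : gamma x = gamma z + r%:C * (gamma y - gamma z) by rewrite -line addrC subrK.
by field.
Qed.

(** When no branch values coincide, the two distinct triples, being of the same
    size, each have a vertex outside the other; these are the vertices solved
    for in [two_collinearities]. *)
Lemma Gamma2_sub a alpha : alpha != 0 ->
  Gamma2 a alpha `<=`
    (\bigcup_s [set p | exists2 gamma, branch_values a p gamma
                                     & branch_coincidence s gamma])
    `|` \bigcup_s [set p | exists2 gamma, branch_values a p gamma
                                        & two_collinearities s.1 s.2 gamma].
Proof.
move=> nz_alpha p [_ [gamma branch AP]].
have [inj_gamma|/existsNP[i /existsNP[l /not_implyP[eq_il /eqP ne_il]]]] :=
    pselect (injective gamma); last first.
  by left; exists (i, l) => //; exists gamma.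
have triple_gamma T : collinear_triple (fun i => alpha * gamma i) T ->
    collinear_triple gamma T.
  move=> [i [j [l [ne_ijl -> [r line]]]]]; exists i, j, l; split=> //; exists r.
  by apply: (mulfI nz_alpha); rewrite mulrCA !mulrBr line !mulrBr.
case: AP => [[i [l [/eqP ne_il /(mulfI nz_alpha)/inj_gamma]]] //|].
move=> [T1 [T2 [ne_T /triple_gamma tri1 /triple_gamma tri2]]]; right.
have card_triple T : collinear_triple gamma T -> #|T| = 3.
  move=> [i [j [l [/and3P[ne_ij ne_jl ne_il] -> _]]]].
  by rewrite finset.setUC cardsU1 cards2 !inE negb_or ne_ij eq_sym ne_il eq_sym ne_jl.
have pick_out S T : collinear_triple gamma S -> collinear_triple gamma T ->
    S != T -> exists2 i, i \in S & i \notin T.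
  move=> /card_triple cS /card_triple cT; rewrite eqEcard cS cT leqnn andbT.
  by case/subsetPn=> i; exists i.
have [i1 i1T1 i1T2] := pick_out _ _ tri1 tri2 ne_T.
have [i2 i2T2 i2T1] : exists2 i, i \in T2 & i \notin T1.
  by apply: pick_out; rewrite // eq_sym.
have [j1 [l1 [ne_ij1 ne_il1 T1E line1]]] := collinear_triple_vertex inj_gamma tri1 i1T1.
have [j2 [l2 [ne_ij2 ne_il2 T2E line2]]] := collinear_triple_vertex inj_gamma tri2 i2T2.
exists ((i1, j1, l1), (i2, j2, l2)) => //; exists gamma => //.
move: i1T2 i2T1; rewrite T1E T2E !inE !negb_or -!andbA => /and3P[? ? ?] /and3P[? ? ?].
by split=> //=; rewrite !inE !negb_or; apply/and5P.
Qed.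

(** The value of the characteristic polynomial at 0 is a_(k,k), the leading
    coefficient of Q_k. *)
Lemma charpoly_root_neq0 a alpha :
  size (Qpoly a ord_max) = k.+1 -> root (charpoly a) alpha -> alpha != 0.
Proof.
move=> sQ; apply: contraTneq => ->.
rewrite rootE horner_coef0 coef_sum big_ord_recr /= big1 => [|i _]; last first.
  by rewrite coefZ coefXn ltn_eqF ?mulr0 // subn_gt0.
rewrite add0r coefZ coefXn subnn mulr1.
have : lead_coef (Qpoly a ord_max) != 0.
  by rewrite lead_coef_eq0 -size_poly_eq0 sQ.
rewrite lead_coefE sQ /= coef_sum (bigD1 ord_max) //= coefZ coefXn eqxx mulr1.
rewrite big1 ?addr0 // => j; rewrite -(inj_eq val_inj) => ne_jk.
by rewrite coefZ coefXn eq_sym (negbTE ne_jk) mulr0.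
Qed.

End PencilPolynomials.

Theorem theorem4 (R : realType) (k : nat) :
  exists Z : set (pencil R k),
    [/\ real_algebraic Z, Z <> setT
      & forall a : pencil R k, general_type a -> ~ Z a ->
          forall alpha : R[i], root (charpoly a) alpha ->
            finite_set (Gamma2 a alpha)].
Proof.
have [f nz_f fin_f] := generically_finite_setU
  (generically_finite_bigcup (@branch_coincidence_generically_finite R k))
  (generically_finite_bigcup
     (fun s => @two_collinearities_generically_finite R k s.1 s.2)).
exists [set a | forall g, g \in [:: f] -> g.@[real_coord a] = 0]; split.
- by exists [:: f].
- have [x fx] := exists_nonzero nz_f; have [a ax] := real_coord_surj x.
  move/seteqP=> [_ /(_ a I)/= /(_ f)]; rewrite inE eqxx => /(_ isT).
  by rewrite ax; apply/eqP.
move=> a [sQ _ _] nZ_a alpha /(charpoly_root_neq0 sQ) nz_alpha.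
apply: sub_finite_set (Gamma2_sub nz_alpha) _.
apply: fin_f; apply: contra_notN nZ_a => /eqP fa g.
by rewrite inE => /eqP->.
Qed.
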